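(* There exists a weak consistent digital ray system (WCDR) $R_o$ in $\mathbb{Z}^2$ whose error in the $L_\infty$ metric is exactly $1.5$; that is, $\sup_{p\in\mathbb{Z}^2} E(R_o(p)) = 1.5$.
   Context: Consider the unit grid graph on $\mathbb{Z}^2$: two points $p=(p_x,p_y)$, $q=(q_x,q_y)$ are adjacent iff $|p_x-q_x|+|p_y-q_y|=1$. Fix a root $o\in\mathbb{Z}^2$. A digital ray system $R_o$ assigns to every $p\in\mathbb{Z}^2$ a set $R_o(p)\subseteq\mathbb{Z}^2$ (the digital segment from $o$ to $p$). It is a weak consistent digital ray system (WCDR) if: (S1) for every $p$, $R_o(p)$ is the vertex set of a path from $o$ to $p$ in the grid graph; (S3) (subsegment property) for every $p$ and every $q\in R_o(p)$, $R_o(q)\subseteq R_o(p)$; (S5) (monotonicity) for every $p$, if $p_x=o_x$ then every $r\in R_o(p)$ has $r_x=o_x$, and if $p_y=o_y$ then every $r\in R_o(p)$ has $r_y=o_y$. (The prolongation property is not required.) The error of a segment is $E(R_o(p))=\max_{v\in R_o(p)} \mathrm{dist}_\infty(v,\overline{op})$, where $\overline{op}$ is the Euclidean segment from $o$ to $p$ and $\mathrm{dist}_\infty$ is the $L_\infty$ distance from a point to a set. The error of the WCDR is $\sup_{p\in\mathbb{Z}^2}E(R_o(p))$. *)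

(* Defs.v *)
From Stdlib Require Import Reals ZArith List.
From Coquelicot Require Import Coquelicot.
Import ListNotations.
Open Scope R_scope.

Definition pt : Type := (Z * Z)%type.

Definition adj (p q : pt) : Prop :=
  (Z.abs (fst p - fst q) + Z.abs (snd p - snd q) = 1)%Z.

Fixpoint chain (l : list pt) : Prop :=
  match l with
  | a :: ((b :: _) as t) => adj a b /\ chain t
  | _ => True
  end.

Definition path_vertex_set (S : pt -> Prop) (a b : pt) : Prop :=
  exists l : list pt,
    NoDup l /\ hd_error l = Some a /\ last l a = b /\ chain l /\
    (forall v, S v <-> In v l).

(* A digital ray system with root o: Rs p v means v \in R_o(p). *)
Definition ray_system : Type := pt -> pt -> Prop.

Definition S1 (o : pt) (Rs : ray_system) : Prop :=
  forall p, path_vertex_set (Rs p) o p.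

Definition S3 (Rs : ray_system) : Prop :=
  forall p q, Rs p q -> forall r, Rs q r -> Rs p r.

Definition S5 (o : pt) (Rs : ray_system) : Prop :=
  forall p,
    (fst p = fst o -> forall r, Rs p r -> fst r = fst o) /\
    (snd p = snd o -> forall r, Rs p r -> snd r = snd o).

Definition WCDR (o : pt) (Rs : ray_system) : Prop :=
  S1 o Rs /\ S3 Rs /\ S5 o Rs.

Definition dist_inf_pt (v : pt) (x y : R) : R :=
  Rmax (Rabs (IZR (fst v) - x)) (Rabs (IZR (snd v) - y)).

Definition dist_seg (v o p : pt) : R :=
  real (Glb_Rbar (fun d => exists t : R, 0 <= t <= 1 /\
     d = dist_inf_pt v (IZR (fst o) + t * (IZR (fst p) - IZR (fst o)))
                       (IZR (snd o) + t * (IZR (snd p) - IZR (snd o))))).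

(* error of the segment R_o(p): max over its vertices (a finite set) *)
Definition seg_error (o : pt) (Rs : ray_system) (p : pt) : R :=
  real (Lub_Rbar (fun d => exists v, Rs p v /\ d = dist_seg v o p)).

Definition system_error (o : pt) (Rs : ray_system) : Rbar :=
  Lub_Rbar (fun e => exists p, e = seg_error o Rs p).

(* Main.v *)
Require Import Defs.
From Stdlib Require Import Reals ZArith List Lia Lra.
From Coquelicot Require Import Coquelicot.
Import ListNotations.
Open Scope Z_scope.

(** In each quadrant a point is described by its level [n = |dx| + |dy|] and its
    index [i = |dx|]; the L_inf distance of [(m, j)] to the segment from the root
    to [(n, i)] is [|j - m u|], where [u = i / n] is the slope.  On the levels
    [M < n <= 2 M], with [M] a power of two, the slopes are cut into the cells
    [[l/M, (l+1)/M]], and every cell owns one trunk, the rounding of the central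
    line of slope [(2 l + 1) / (2 M)].  Rounding costs at most 1/2 and the
    half-width of the cell at most 1, which gives 3/2.  On level [2 M] the trunk
    sits exactly at [2 l + 1], from where it forks into the trunks of the two
    halves of its cell.  A point off the trunk of its cell runs parallel to an
    axis until it meets that trunk, and nothing forces its ray to be prolonged.
    On the levels up to 4 the paths are chosen so that the ray of (3, 3) passes
    through (3, 0), at distance exactly 3/2 from the segment. *)

(** * The parent map on levels and indices *)

Definition block (n : Z) : Z := 2 ^ Z.log2 (n - 1).

(* [n (2 l + 1) / (2 M)] rounded to the nearest integer. *)
Definition trunk (M n l : Z) : Z := (n * (2 * l + 1) + M) / (2 * M).

(* Index of the parent of [(n, i)], on level [n - 1]. *)
Definition next (n i : Z) : Z :=
  if ((n <=? 4) || (i <=? 0) || (n <=? i))%bool then Z.min i (n - 1)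
  else
    let M := block n in
    let l := i * M / n in
    let a := trunk M n l in
    if i <? a then i
    else if a <? i then i - 1
    else if n - 1 =? M then 2 * (l / 2) + 1
    else trunk M (n - 1) l.

(* Index of the ancestor of [(n, i)] on level [n - d]. *)
Fixpoint trace (d : nat) (n i : Z) : Z :=
  match d with
  | O => i
  | S d => trace d (n - 1) (next n i)
  end.

(** * Arithmetic of blocks, cells and trunks *)

Lemma block_spec (n : Z) : 5 <= n ->
  exists M', block n = 2 * M' /\ 2 <= M' /\ 2 * M' < n <= 4 * M'.
Proof.
  intros hn. unfold block.
  pose proof (Z.log2_spec (n - 1) ltac:(lia)) as [h1 h2].
  assert (h3 : 2 <= Z.log2 (n - 1)) by (apply Z.log2_le_pow2; simpl; lia).
  set (k := Z.log2 (n - 1)) in *.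
  exists (2 ^ (k - 1)).
  assert (e : 2 ^ k = 2 * 2 ^ (k - 1)).
  { rewrite <- Z.pow_succ_r by lia. f_equal. lia. }
  rewrite Z.pow_succ_r in h2 by lia.
  assert (2 ^ 1 <= 2 ^ (k - 1)) by (apply Z.pow_le_mono_r; lia).
  change (2 ^ 1) with 2 in *. lia.
Qed.

Lemma block_pred (n : Z) : 5 <= n -> n - 1 <> block n -> block (n - 1) = block n.
Proof.
  intros hn h. unfold block in *.
  pose proof (Z.log2_spec (n - 1) ltac:(lia)) as [h1 h2].
  rewrite (Z.log2_unique (n - 1 - 1) (Z.log2 (n - 1))); [easy | apply Z.log2_nonneg | lia].
Qed.

Lemma block_at_block (n : Z) : 6 <= n -> n - 1 = block n -> block n = 2 * block (n - 1).
Proof.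
  intros hn h. unfold block in *.
  set (k := Z.log2 (n - 1)) in *.
  assert (h3 : 2 <= k) by (apply Z.log2_le_pow2; simpl; lia).
  assert (e : 2 ^ k = 2 * 2 ^ (k - 1)).
  { rewrite <- Z.pow_succ_r by lia. f_equal. lia. }
  assert (2 ^ 1 <= 2 ^ (k - 1)) by (apply Z.pow_le_mono_r; lia).
  change (2 ^ 1) with 2 in *.
  rewrite (Z.log2_unique (n - 1 - 1) (k - 1)); [easy | lia |].
  replace (Z.succ (k - 1)) with k by lia. lia.
Qed.

Lemma trunk_spec (M n l : Z) : 0 < M ->
  2 * M * trunk M n l <= n * (2 * l + 1) + M < 2 * M * trunk M n l + 2 * M.
Proof.
  intros hM. unfold trunk.
  pose proof (Z.div_mod (n * (2 * l + 1) + M) (2 * M) ltac:(lia)).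
  pose proof (Z.mod_pos_bound (n * (2 * l + 1) + M) (2 * M) ltac:(lia)). lia.
Qed.

Lemma div_spec (a b : Z) : 0 < b -> b * (a / b) <= a < b * (a / b) + b.
Proof.
  intros hb. pose proof (Z.div_mod a b ltac:(lia)).
  pose proof (Z.mod_pos_bound a b hb). lia.
Qed.

Lemma cell_bound (M n i : Z) : 0 < M -> 0 < i < n -> 0 <= i * M / n < M.
Proof.
  intros hM hi. split; [apply Z.div_pos; nia | apply Z.div_lt_upper_bound; nia].
Qed.

(** The central line is at [l + 1/2 + (2 l + 1) / (2 M)], less than 1 above a half-integer. So the
    [M] trunks occupy all interior indices of level [M + 1]. *)
Lemma trunk_first (M l : Z) : 0 <= l < M -> trunk M (M + 1) l = l + 1.
Proof.
  intros hl. symmetry. unfold trunk.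
  apply Z.div_unique with (r := 2 * l + 1); nia.
Qed.

Lemma trunk_last (M l : Z) : 0 < M -> trunk M (2 * M) l = 2 * l + 1.
Proof.
  intros hM. symmetry. unfold trunk. apply Z.div_unique with (r := M); nia.
Qed.

(** The slope of the central line lies strictly between 0 and 1; hence consecutive trunk points are
    grid neighbours. *)
Lemma trunk_step (M n l : Z) : 0 <= l < M ->
  trunk M n l - 1 <= trunk M (n - 1) l <= trunk M n l.
Proof.
  intros hl.
  pose proof (trunk_spec M n l ltac:(lia)).
  pose proof (trunk_spec M (n - 1) l ltac:(lia)). nia.
Qed.

Lemma trunk_interior (M n l : Z) : 0 <= l < M -> M < n -> 1 <= trunk M n l <= n - 1.
Proof.
  intros hl hn. pose proof (trunk_spec M n l ltac:(lia)). nia.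
Qed.

(** On level [n] the cell has width [n / M > 1], and rounding moves its centre by at most 1/2. *)
Lemma cell_trunk (M n l : Z) : 0 <= l < M -> M < n -> trunk M n l * M / n = l.
Proof.
  intros hl hn. pose proof (trunk_spec M n l ltac:(lia)).
  symmetry. apply Z.div_unique with (r := trunk M n l * M - n * l); nia.
Qed.

Lemma next_range (n i : Z) : 1 <= n -> 0 <= i <= n ->
  i - 1 <= next n i <= i /\ 0 <= next n i <= n - 1.
Proof.
  intros hn hi. unfold next.
  destruct (Z.leb_spec n 4), (Z.leb_spec i 0), (Z.leb_spec n i); cbn [orb]; try lia.
  destruct (block_spec n ltac:(lia)) as (M' & eM & hM' & hnM).
  set (M := block n) in *. set (l := i * M / n).
  assert (hl : 0 <= l < M) by (apply cell_bound; lia).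
  pose proof (trunk_interior M n l hl ltac:(lia)).
  destruct (Z.ltb_spec i (trunk M n l)); [lia |].
  destruct (Z.ltb_spec (trunk M n l) i); [lia |].
  destruct (Z.eqb_spec (n - 1) M) as [e | e].
  - assert (ea : trunk M n l = l + 1)
      by (replace n with (M + 1) by lia; apply trunk_first; lia).
    pose proof (div_spec l 2 ltac:(lia)). lia.
  - pose proof (trunk_step M n l hl).
    pose proof (trunk_interior M (n - 1) l hl ltac:(lia)). lia.
Qed.

Lemma trace_range (d : nat) : forall n i, Z.of_nat d <= n -> 0 <= i <= n ->
  0 <= trace d n i <= i /\ 0 <= n - Z.of_nat d - trace d n i <= n - i.
Proof.
  induction d as [| d IH]; intros n i hd hi; [simpl; lia |].
  cbn [trace]. pose proof (next_range n i ltac:(lia) hi).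
  specialize (IH (n - 1) (next n i) ltac:(lia) ltac:(lia)). lia.
Qed.

(** * The bound 3/2 inside a quadrant *)

Ltac eval_trace :=
  match goal with
  | |- context [trace ?d ?n ?i] =>
    let t := eval vm_compute in (trace d n i) in change (trace d n i) with t
  end.

(* [|j - m u| <= 3/2] for the slope [u = P/Q]. *)
Definition close (P Q m j : Z) : Prop := 2 * Z.abs (j * Q - m * P) <= 3 * Q.

(** Base of the descent: the trunks for [M = 2] reach level 4 at 1 and 3, and both paths are checked
    vertex by vertex. *)
Lemma trace_close_root_block (d : nat) (l P Q : Z) :
  (d <= 4)%nat -> 0 < Q -> 0 <= l < 2 -> l * Q <= 2 * P <= (l + 1) * Q ->
  close P Q (4 - Z.of_nat d) (trace d 4 (2 * l + 1)).
Proof.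
  intros hd hQ hl hP. unfold close.
  assert (l = 0 \/ l = 1) as [-> | ->] by lia;
  (destruct d as [| [| [| [| [| d]]]]]; [.. | lia]); eval_trace; lia.
Qed.

(** The centre is within [n / (2 M) <= 1] of [n u], and on the trunk rounding adds 1/2. Below the
    trunk [0 <= i - n u] is assumed while [i] is at least 1/2 below the centre, so the difference is
    at most 1/2; above it the signs flip. *)
Lemma close_of_cell (M n i l P Q : Z) : 0 < M < n -> n <= 2 * M -> 0 < Q ->
  l * Q <= M * P <= (l + 1) * Q ->
  (i < trunk M n l -> n * P <= i * Q) -> (trunk M n l < i -> i * Q <= n * P) ->
  close P Q n i.
Proof.
  intros hM hn hQ [hc1 hc2] hlow hhigh.
  pose proof (trunk_spec M n l ltac:(lia)) as [ha1 ha2].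
  set (a := trunk M n l) in *.
  apply (Z.mul_le_mono_nonneg_l _ _ n ltac:(lia)) in hc1, hc2.
  pose proof (Z.mul_le_mono_nonneg_r _ _ Q ltac:(lia) hn) as hnQ.
  assert (h : - (3 * Q) <= 2 * (i * Q - n * P) <= 3 * Q); [| unfold close; lia].
  destruct (Z.lt_trichotomy i a) as [c | [c | c]].
  - specialize (hlow c). split; [lia |].
    apply Z.mul_le_mono_pos_l with (p := M); [lia |].
    assert (h : 2 * M * i <= n * (2 * l + 1) - M) by nia.
    apply (Z.mul_le_mono_nonneg_r _ _ Q ltac:(lia)) in h. lia.
  - rewrite <- c in *.
    apply (Z.mul_le_mono_nonneg_r _ _ Q ltac:(lia)) in ha1.
    apply Z.lt_le_incl, (Z.mul_le_mono_nonneg_r _ _ Q ltac:(lia)) in ha2.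
    split; apply Z.mul_le_mono_pos_l with (p := M); lia.
  - specialize (hhigh c). split; [| lia].
    apply Z.mul_le_mono_pos_l with (p := M); [lia |].
    assert (h : n * (2 * l + 1) + M <= 2 * M * i) by nia.
    apply (Z.mul_le_mono_nonneg_r _ _ Q ltac:(lia)) in h. lia.
Qed.

(* The slope [u = P/Q] of a descendant is kept arbitrary in the cell, but below
   the trunk only [n u <= i] and above it only [i <= n u] are allowed: both
   conditions pass to the parent, since the ray runs parallel to an axis there. *)
Lemma trace_close (d : nat) : forall n i P Q,
  5 <= n -> 0 < i < n -> Z.of_nat d <= n -> 0 <= P <= Q -> 0 < Q ->
  let M := block n in let l := i * M / n in let a := trunk M n l in
  l * Q <= M * P <= (l + 1) * Q ->
  (i < a -> n * P <= i * Q) -> (a < i -> i * Q <= n * P) ->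
  close P Q (n - Z.of_nat d) (trace d n i).
Proof.
  induction d as [| d IH]; intros n i P Q hn hi hd hP hQ M l a hcell hlow hhigh;
    destruct (block_spec n hn) as (M' & eM & hM' & hnM); fold M in eM;
    assert (hl : 0 <= l < M) by (apply cell_bound; lia);
    pose proof (trunk_spec M n l ltac:(lia)) as ha; fold a in ha.
  - cbn [trace]. unfold close. rewrite Z.sub_0_r.
    apply close_of_cell with (M := M) (l := l); try easy; lia.
  - cbn [trace]. replace (n - Z.of_nat (S d)) with (n - 1 - Z.of_nat d) by lia.
    pose proof (div_spec (i * M) n ltac:(lia)) as hdiv. fold l in hdiv.
    pose proof (trunk_interior M n l hl ltac:(lia)) as hin. fold a in hin.
    assert (hnext : next n i = if i <? a then i else if a <? i then i - 1
              else if n - 1 =? M then 2 * (l / 2) + 1 else trunk M (n - 1) l).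
    { unfold next.
      destruct (Z.leb_spec n 4), (Z.leb_spec i 0), (Z.leb_spec n i); cbn [orb]; try lia.
      reflexivity. }
    rewrite hnext.
    destruct (Z.eqb_spec (n - 1) M) as [e | e].
    + assert (ea : a = l + 1).
      { unfold a. replace n with (M + 1) by lia. apply trunk_first. lia. }
      (* On level [M + 1] the only interior index in cell [l] is [l + 1], so [i] is on the trunk. *)
      destruct (Z.ltb_spec i a); [nia |].
      destruct (Z.ltb_spec a i); [nia |].
      pose proof (div_spec l 2 ltac:(lia)) as hl2.
      set (l' := l / 2) in *.
      destruct (Z.eq_dec n 5) as [-> | hn5].
      * change (block 5) with 4 in M. unfold M in *.
        apply trace_close_root_block; try lia.
        assert (l = 2 * l' \/ l = 2 * l' + 1) as [el | el] by lia; rewrite el in *; lia.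
      * pose proof (block_at_block n ltac:(lia) e) as eb. fold M in eb.
        assert (eN : n - 1 = 2 * block (n - 1)) by lia.
        set (N := block (n - 1)) in *.
        (* The parent is the end of the trunk of the coarser cell [l / 2], which contains cell [l];
           the slope condition therefore persists. *)
        assert (et : 2 * l' + 1 = trunk N (n - 1) l').
        { rewrite eN, trunk_last; lia. }
        assert (ec : (2 * l' + 1) * N / (n - 1) = l').
        { rewrite et. apply cell_trunk; lia. }
        apply IH; fold N; try lia; rewrite ec; rewrite <- ?et; try lia.
        assert (hcell' : l * Q <= 2 * N * P <= (l + 1) * Q) by (rewrite <- eb; exact hcell).
        assert (l = 2 * l' \/ l = 2 * l' + 1) as [el | el] by lia; rewrite el in hcell'; lia.
    + pose proof (block_pred n hn e) as eb. fold M in eb.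
      pose proof (trunk_step M n l hl) as hs. fold a in hs.
      pose proof (trunk_spec M (n - 1) l ltac:(lia)) as hb.
      set (b := trunk M (n - 1) l) in *.
      assert (hM1 : M < n - 1) by lia.
      assert (hn5 : 5 <= n - 1) by lia.
      destruct (Z.ltb_spec i a); [| destruct (Z.ltb_spec a i)].
      (* The trunk drops by at most 1, so [i <= b] and the parent stays in the cell. *)
      * assert (ec : i * M / (n - 1) = l).
        { symmetry. apply Z.div_unique with (r := i * M - (n - 1) * l); [| lia].
          pose proof (Z.mul_le_mono_nonneg_l i b M ltac:(lia) ltac:(lia)). lia. }
        apply IH; try lia; rewrite eb, ec; fold b; lia.
      (* Here [b <= i - 1]. Index and level drop together, and [P <= Q] carries [i Q <= n P] over to
         the parent. *)
      * assert (ec : (i - 1) * M / (n - 1) = l).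
        { symmetry. apply Z.div_unique with (r := (i - 1) * M - (n - 1) * l); [| lia].
          pose proof (Z.mul_le_mono_nonneg_l b (i - 1) M ltac:(lia) ltac:(lia)). lia. }
        apply IH; try lia; rewrite eb, ec; fold b; lia.
      (* On the trunk both sign conditions are vacuous for the parent. *)
      * assert (ec : b * M / (n - 1) = l) by (apply cell_trunk; lia).
        pose proof (trunk_interior M (n - 1) l hl hM1) as hbi. fold b in hbi.
        apply IH; try lia; rewrite eb, ec; fold b; lia.
Qed.

Lemma trace_left_axis (d : nat) : forall n, Z.of_nat d <= n -> trace d n 0 = 0.
Proof.
  induction d as [| d IH]; intros n hd; [easy |].
  cbn [trace]. pose proof (next_range n 0 ltac:(lia) ltac:(lia)).
  replace (next n 0) with 0 by lia. apply IH. lia.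
Qed.

Lemma trace_right_axis (d : nat) : forall n, Z.of_nat d <= n -> trace d n n = n - Z.of_nat d.
Proof.
  induction d as [| d IH]; intros n hd; [simpl; lia |].
  cbn [trace]. pose proof (next_range n n ltac:(lia) ltac:(lia)).
  replace (next n n) with (n - 1) by lia. rewrite IH; lia.
Qed.

Lemma trace_close_self (d : nat) (n i : Z) :
  1 <= n -> 0 <= i <= n -> Z.of_nat d <= n -> close i n (n - Z.of_nat d) (trace d n i).
Proof.
  intros hn hi hd.
  destruct (Z.eq_dec i 0) as [-> | h0].
  { rewrite trace_left_axis by lia. unfold close. lia. }
  destruct (Z.eq_dec i n) as [-> | h1].
  { rewrite trace_right_axis by lia. unfold close. lia. }
  destruct (Z_le_gt_dec n 4) as [h4 | h4].
  - assert (n = 1 \/ n = 2 \/ n = 3 \/ n = 4) as hn4 by lia.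
    assert (i = 1 \/ i = 2 \/ i = 3) as hi3 by lia.
    unfold close.
    destruct hn4 as [-> | [-> | [-> | ->]]], hi3 as [-> | [-> | ->]]; try lia;
    (destruct d as [| [| [| [| [| d]]]]]; [.. | lia]); eval_trace; lia.
  - destruct (block_spec n ltac:(lia)) as (M' & eM & hM' & hnM).
    pose proof (div_spec (i * block n) n ltac:(lia)).
    (* For [u = i / n] both sign conditions hold with equality. *)
    apply trace_close; lia.
Qed.

(** * Transport to the four quadrants around the root *)

Definition norm1 (o p : pt) : Z := Z.abs (fst p - fst o) + Z.abs (snd p - snd o).

Definition parent (o p : pt) : pt :=
  let n := norm1 o p in
  let j := next n (Z.abs (fst p - fst o)) in
  (fst o + Z.sgn (fst p - fst o) * j, snd o + Z.sgn (snd p - snd o) * (n - 1 - j)).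

Definition ancestor (o : pt) (d : nat) (p : pt) : pt := Nat.iter d (parent o) p.

(** Rays are ancestor sets in a tree, which makes the subsegment property automatic. *)
Definition rays (o : pt) : ray_system :=
  fun p v => exists d, Z.of_nat d <= norm1 o p /\ v = ancestor o d p.

Lemma parent_spec (o p : pt) : 1 <= norm1 o p ->
  norm1 o (parent o p) = norm1 o p - 1 /\ adj (parent o p) p /\
  Z.abs (fst (parent o p) - fst o) = next (norm1 o p) (Z.abs (fst p - fst o)).
Proof.
  destruct o as [ox oy], p as [px py]. unfold parent, norm1, adj. cbn [fst snd].
  intros h.
  pose proof (next_range (Z.abs (px - ox) + Z.abs (py - oy)) (Z.abs (px - ox)) h ltac:(lia)).
  set (j := next _ _) in *.
  destruct (Z.sgn_spec (px - ox)) as [[? ->] | [[? ->] | [? ->]]],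
    (Z.sgn_spec (py - oy)) as [[? ->] | [[? ->] | [? ->]]]; lia.
Qed.

Lemma ancestor_S (o : pt) (d : nat) (p : pt) : ancestor o (S d) p = ancestor o d (parent o p).
Proof. apply Nat.iter_succ_r. Qed.

Lemma norm1_ancestor (o : pt) (d : nat) : forall p, Z.of_nat d <= norm1 o p ->
  norm1 o (ancestor o d p) = norm1 o p - Z.of_nat d.
Proof.
  induction d as [| d IH]; intros p hd; [simpl; lia |].
  rewrite ancestor_S. destruct (parent_spec o p ltac:(lia)) as (h & _).
  rewrite IH; lia.
Qed.

Lemma norm1_eq_0 (o p : pt) : norm1 o p = 0 -> p = o.
Proof.
  destruct o, p. unfold norm1. cbn [fst snd]. intros h. f_equal; lia.
Qed.

(** A coordinate that reaches 0 loses its sign, but then [j] is 0 too; so the signs of the starting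
    point serve along the whole ray. *)
Lemma sgn_sgn_mul (s b j : Z) : 0 <= j <= b -> Z.sgn (Z.sgn s * b) * j = Z.sgn s * j.
Proof.
  intros h. rewrite Z.sgn_mul, Z.sgn_sgn.
  destruct (Z.sgn_spec b) as [[? ->] | [[? ->] | [? ->]]]; nia.
Qed.

Lemma ancestor_eq (o : pt) (d : nat) : forall p, Z.of_nat d <= norm1 o p ->
  let n := norm1 o p in
  let j := trace d n (Z.abs (fst p - fst o)) in
  ancestor o d p = (fst o + Z.sgn (fst p - fst o) * j,
                    snd o + Z.sgn (snd p - snd o) * (n - Z.of_nat d - j)).
Proof.
  induction d as [| d IH]; intros p hd; cbn zeta.
  - cbn. destruct o as [ox oy], p as [px py]. unfold norm1. cbn [fst snd]. f_equal; lia.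
  - rewrite ancestor_S. destruct (parent_spec o p ltac:(lia)) as (h & _ & h').
    rewrite IH by lia. cbn [trace]. rewrite h, h'.
    set (n := norm1 o p) in *. set (i := Z.abs (fst p - fst o)) in *.
    assert (hi : 0 <= i <= n) by (unfold i, n, norm1; lia).
    pose proof (next_range n i ltac:(lia) hi) as hr.
    pose proof (trace_range d (n - 1) (next n i) ltac:(lia) ltac:(lia)) as ht.
    set (j := trace d (n - 1) (next n i)) in *.
    replace (n - Z.of_nat (S d)) with (n - 1 - Z.of_nat d) by lia.
    assert (e1 : fst (parent o p) - fst o = Z.sgn (fst p - fst o) * next n i)
      by (cbn; unfold n, i; lia).
    assert (e2 : snd (parent o p) - snd o = Z.sgn (snd p - snd o) * (n - 1 - next n i))
      by (cbn; unfold n, i; lia).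
    rewrite e1, e2, !sgn_sgn_mul by lia. reflexivity.
Qed.

(** * Rays as grid paths *)

Fixpoint ray (o : pt) (d : nat) (p : pt) : list pt :=
  match d with
  | O => [p]
  | S d => ray o d (parent o p) ++ [p]
  end.

Lemma chain_snoc (l : list pt) (a p : pt) :
  chain (l ++ [a]) -> adj a p -> chain ((l ++ [a]) ++ [p]).
Proof.
  induction l as [| b l IH]; cbn; [tauto |].
  intros h ha. destruct l as [| c l]; cbn in *; [tauto |].
  split; [apply h |]. apply IH; tauto.
Qed.

Lemma ray_last (o : pt) (d : nat) (p : pt) : exists l, ray o d p = l ++ [p].
Proof. destruct d; [exists nil | eexists]; reflexivity. Qed.

Lemma ray_head (o : pt) (d : nat) : forall p, hd_error (ray o d p) = Some (ancestor o d p).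
Proof.
  induction d as [| d IH]; intros p; [easy |].
  rewrite ancestor_S, <- IH. cbn.
  destruct (ray_last o d (parent o p)) as [[| b l] ->]; reflexivity.
Qed.

Lemma in_ray (o v : pt) (d : nat) : forall p,
  In v (ray o d p) <-> exists e, (e <= d)%nat /\ v = ancestor o e p.
Proof.
  induction d as [| d IH]; intros p.
  - cbn. split.
    + intros [<- | []]. exists O. easy.
    + intros (e & he & ->). left. replace e with O by lia. reflexivity.
  - cbn [ray]. rewrite in_app_iff, IH. split.
    + intros [(e & he & ->) | [<- | []]].
      * exists (S e). split; [lia |]. now rewrite ancestor_S.
      * exists O. split; [lia | easy].
    + intros ([| e] & he & ->); [right; left; easy |].
      left. exists e. split; [lia |]. apply ancestor_S.
Qed.

(** Levels strictly increase along the list, so no vertex repeats. *)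
Lemma ray_path (o : pt) (d : nat) : forall p, Z.of_nat d <= norm1 o p ->
  NoDup (ray o d p) /\ chain (ray o d p).
Proof.
  induction d as [| d IH]; intros p hd.
  - cbn. split; [repeat constructor; easy | easy].
  - destruct (parent_spec o p ltac:(lia)) as (h & hadj & _).
    destruct (IH (parent o p) ltac:(lia)) as [hnd hch]. cbn [ray]. split.
    + apply NoDup_app; [easy | repeat constructor; easy |].
      intros v hv [<- | []]. apply in_ray in hv. destruct hv as (e & he & hp).
      pose proof (norm1_ancestor o e (parent o p) ltac:(lia)) as hn.
      rewrite <- hp in hn. lia.
    + destruct (ray_last o d (parent o p)) as [l e]. rewrite e in *.
      apply chain_snoc; assumption.
Qed.

Lemma norm1_nonneg (o p : pt) : 0 <= norm1 o p.
Proof. unfold norm1. lia. Qed.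

Lemma rays_WCDR (o : pt) : WCDR o (rays o).
Proof.
  split; [| split].
  - intros p. pose proof (norm1_nonneg o p) as hn.
    set (d := Z.to_nat (norm1 o p)).
    assert (hd : Z.of_nat d = norm1 o p) by (apply Z2Nat.id; easy).
    destruct (ray_path o d p ltac:(lia)) as [hnd hch].
    exists (ray o d p). split; [easy |]. split; [| split; [| split; [easy |]]].
    + rewrite ray_head. f_equal. apply norm1_eq_0. rewrite norm1_ancestor; lia.
    + destruct (ray_last o d p) as [l ->]. apply last_last.
    + intros v. rewrite in_ray. unfold rays.
      split; intros (e & he & ->); exists e; split; try easy; lia.
  - intros p q (d & hd & ->) r (e & he & ->).
    rewrite norm1_ancestor in he by easy.
    exists (e + d)%nat. split; [lia |]. symmetry. apply Nat.iter_add.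
  (* A zero sign annihilates the corresponding offset of every ancestor. *)
  - intros p. split; intros h r (d & hd & ->); rewrite ancestor_eq by easy; cbn [fst snd];
      rewrite h, Z.sub_diag; cbn [Z.sgn]; lia.
Qed.

(** * Distances and errors *)

Open Scope R_scope.

Lemma dist_inf_pt_nonneg (v : pt) (x y : R) : 0 <= dist_inf_pt v x y.
Proof.
  unfold dist_inf_pt. eapply Rle_trans; [apply Rabs_pos | apply Rmax_l].
Qed.

(** [real] sends infinite values to 0, so finiteness must be proved: 0 is a lower bound and [t = 0]
    supplies an element. *)
Lemma is_glb_dist_seg (v o p : pt) :
  is_glb_Rbar (fun d => exists t : R, 0 <= t <= 1 /\
     d = dist_inf_pt v (IZR (fst o) + t * (IZR (fst p) - IZR (fst o)))
                       (IZR (snd o) + t * (IZR (snd p) - IZR (snd o))))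
    (Finite (dist_seg v o p)).
Proof.
  unfold dist_seg. set (E := fun d => _).
  pose proof (Glb_Rbar_correct E) as hg.
  assert (h0 : Rbar_le (Finite 0) (Glb_Rbar E)).
  { apply hg. intros d (t & _ & ->). apply dist_inf_pt_nonneg. }
  assert (h1 : Rbar_le (Glb_Rbar E) (Finite (dist_inf_pt v (IZR (fst o) + 0 * (IZR (fst p) - IZR (fst o)))
                       (IZR (snd o) + 0 * (IZR (snd p) - IZR (snd o)))))).
  { apply hg. exists 0. split; [lra | easy]. }
  destruct (Glb_Rbar E); cbn in *; easy.
Qed.

Lemma dist_seg_le (v o p : pt) (t b : R) : 0 <= t <= 1 ->
  dist_inf_pt v (IZR (fst o) + t * (IZR (fst p) - IZR (fst o)))
                (IZR (snd o) + t * (IZR (snd p) - IZR (snd o))) <= b ->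
  dist_seg v o p <= b.
Proof.
  intros ht hb. refine (Rle_trans _ _ _ _ hb).
  apply (proj1 (is_glb_dist_seg v o p)). now exists t.
Qed.

Lemma dist_seg_ge (v o p : pt) (b : R) :
  (forall t, 0 <= t <= 1 ->
    b <= dist_inf_pt v (IZR (fst o) + t * (IZR (fst p) - IZR (fst o)))
                (IZR (snd o) + t * (IZR (snd p) - IZR (snd o)))) ->
  b <= dist_seg v o p.
Proof.
  intros hb. apply (proj2 (is_glb_dist_seg v o p) (Finite b)).
  intros d (t & ht & ->). now apply hb.
Qed.

Lemma Rabs_sgn_mul_le (z : Z) (x b : R) : Rabs x <= b -> Rabs (IZR (Z.sgn z) * x) <= b.
Proof.
  intros h. rewrite Rabs_mult.
  assert (hs : Rabs (IZR (Z.sgn z)) <= 1).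
  { rewrite <- abs_IZR. apply IZR_le. lia. }
  pose proof (Rabs_pos x). nra.
Qed.

(* The vertex on level [m] is compared with the point of the segment on the same level. *)
Lemma rays_close (o p v : pt) : rays o p v -> dist_seg v o p <= 3 / 2.
Proof.
  intros (d & hd & ->).
  destruct (Z.eq_dec (norm1 o p) 0) as [h0 | h0].
  { replace d with O by lia. apply norm1_eq_0 in h0. subst p. cbn.
    apply dist_seg_le with (t := 0); [lra |]. unfold dist_inf_pt.
    rewrite !Rmult_0_l, !Rplus_0_r, !Rminus_diag, Rabs_R0, Rmax_left; lra. }
  pose proof (norm1_nonneg o p) as hn.
  rewrite ancestor_eq by easy.
  set (n := norm1 o p) in *. set (i := Z.abs (fst p - fst o)) in *.
  assert (hi : (0 <= i <= n)%Z) by (unfold i, n, norm1; lia).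
  pose proof (trace_close_self d n i ltac:(lia) hi hd) as hc. unfold close in hc.
  set (j := trace d n i) in *. set (m := (n - Z.of_nat d)%Z) in *.
  assert (hnR : 0 < IZR n) by (apply IZR_lt; lia).
  assert (hm : 0 <= IZR m <= IZR n) by (split; apply IZR_le; lia).
  assert (hj : Rabs (IZR j - IZR m / IZR n * IZR i) <= 3 / 2).
  { replace (IZR j - IZR m / IZR n * IZR i)
      with (IZR (j * n - m * i) / IZR n)
      by (rewrite minus_IZR, !mult_IZR; field; lra).
    unfold Rdiv at 1. rewrite Rabs_mult, Rabs_inv, (Rabs_pos_eq (IZR n)) by lra.
    apply Rmult_le_reg_r with (IZR n); [easy |].
    rewrite Rmult_assoc, Rinv_l, Rmult_1_r by lra.
    apply IZR_le in hc. rewrite !mult_IZR, abs_IZR in hc. lra. }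
  assert (ex : IZR (fst p) - IZR (fst o) = IZR (Z.sgn (fst p - fst o)) * IZR i).
  { rewrite <- minus_IZR, <- mult_IZR. f_equal. unfold i. lia. }
  assert (ey : IZR (snd p) - IZR (snd o) = IZR (Z.sgn (snd p - snd o)) * (IZR n - IZR i)).
  { rewrite <- !minus_IZR, <- mult_IZR. f_equal. unfold i, n, norm1. lia. }
  apply dist_seg_le with (t := IZR m / IZR n).
  { split; [apply Rdiv_le_0_compat; lra |].
    apply Rmult_le_reg_r with (IZR n); [easy |].
    unfold Rdiv. rewrite Rmult_assoc, Rinv_l by lra. lra. }
  unfold dist_inf_pt. cbn [fst snd]. rewrite ex, ey, !plus_IZR, !mult_IZR, minus_IZR.
  apply Rmax_lub.
  - replace (_ - _) with (IZR (Z.sgn (fst p - fst o)) * (IZR j - IZR m / IZR n * IZR i)) by ring.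
    now apply Rabs_sgn_mul_le.
  (* Both points lie on level [m], so up to the quadrant signs the two deviations are opposite. *)
  - replace (_ - _) with
      (IZR (Z.sgn (snd p - snd o)) * - (IZR j - IZR m / IZR n * IZR i)) by (field; lra).
    apply Rabs_sgn_mul_le. now rewrite Rabs_Ropp.
Qed.

(** Finiteness again: 3/2 is an upper bound, and [p] lies on its own ray. *)
Lemma is_lub_seg_error (o p : pt) :
  is_lub_Rbar (fun d => exists v, rays o p v /\ d = dist_seg v o p)
    (Finite (seg_error o (rays o) p)).
Proof.
  unfold seg_error. set (E := fun d => _).
  pose proof (Lub_Rbar_correct E) as hl.
  assert (h0 : Rbar_le (Lub_Rbar E) (Finite (3 / 2))).
  { apply hl. intros d (v & hv & ->). now apply rays_close. }
  assert (h1 : Rbar_le (Finite (dist_seg p o p)) (Lub_Rbar E)).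
  { apply hl. exists p. split; [| easy]. exists O. split; [apply norm1_nonneg | easy]. }
  destruct (Lub_Rbar E); cbn in *; easy.
Qed.

(** * Attainment of 3/2 *)

Lemma dist_seg_extremal (ox oy : Z) :
  3 / 2 <= dist_seg ((ox + 3)%Z, oy) (ox, oy) ((ox + 3)%Z, (oy + 3)%Z).
Proof.
  apply dist_seg_ge. intros t ht. unfold dist_inf_pt. cbn [fst snd].
  rewrite !plus_IZR.
  (* The deviations [3 - 3 t] and [3 t] balance at [t = 1/2]. *)
  destruct (Rle_lt_dec t (1 / 2)).
  - eapply Rle_trans; [| apply Rmax_l]. eapply Rle_trans; [| apply Rle_abs]. lra.
  - eapply Rle_trans; [| apply Rmax_r]. rewrite Rabs_minus_sym.
    eapply Rle_trans; [| apply Rle_abs]. lra.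
Qed.

Lemma rays_extremal (ox oy : Z) :
  rays (ox, oy) ((ox + 3)%Z, (oy + 3)%Z) ((ox + 3)%Z, oy).
Proof.
  (* The index stays 3 from level 6 down to level 3: three vertical steps. *)
  exists 3%nat.
  assert (hn : norm1 (ox, oy) ((ox + 3)%Z, (oy + 3)%Z) = 6%Z)
    by (unfold norm1; cbn [fst snd]; lia).
  split; [lia |]. rewrite ancestor_eq by lia. rewrite hn. cbn [fst snd].
  replace (ox + 3 - ox)%Z with 3%Z by lia. replace (oy + 3 - oy)%Z with 3%Z by lia.
  change (trace 3 6 (Z.abs 3)) with 3%Z. cbn [Z.sgn]. f_equal; lia.
Qed.

Theorem theorem1 : forall o : pt,
  exists Rs : ray_system, WCDR o Rs /\ system_error o Rs = Finite (3 / 2).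
Proof.
  intros o. exists (rays o). split; [apply rays_WCDR |].
  apply is_lub_Rbar_unique. split.
  - intros e (p & ->). apply (proj2 (is_lub_seg_error o p) (Finite (3 / 2))).
    intros d (v & hv & ->). now apply rays_close.
  - intros b hb. destruct o as [ox oy].
    eapply Rbar_le_trans; [| apply hb; exists ((ox + 3)%Z, (oy + 3)%Z); reflexivity].
    eapply Rle_trans; [apply dist_seg_extremal |].
    apply (proj1 (is_lub_seg_error (ox, oy) _)).
    eexists. split; [apply rays_extremal | easy].
Qed.
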